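(* Let $n \geq 3$. Let $G \colon \mathbf{Ring}^{\mathrm{op}} \to \mathbf{Loc}$ be any functor that assigns to each commutative ring its Zariski spectrum, i.e. the restriction of $G$ to $\mathbf{cRing}^{\mathrm{op}}$ is the Zariski spectrum functor $\mathrm{Spec} \colon \mathbf{cRing}^{\mathrm{op}} \to \mathbf{Loc}$ (up to natural isomorphism). Then $G$ trivializes on the ring $\mathbb{M}_n(\mathbb{C})$ of $n$-by-$n$ complex matrices: $G(\mathbb{M}_n(\mathbb{C}))$ is an initial object of $\mathbf{Loc}$, that is, isomorphic to the locale of opens of the empty topological space.
   Context: All rings are unital. $\mathbf{Ring}$ is the category of (not necessarily commutative) rings and unital ring homomorphisms, and $\mathbf{cRing}$ is its full subcategory of commutative rings. A locale is a complete lattice $L$ satisfying $\bigvee_i (x \wedge y_i) = x \wedge \bigvee_i y_i$. A morphism of locales $K \to L$ is a function $f \colon L \to K$ (note the direction) preserving finite meets (including the top element) and arbitrary joins. These form the category $\mathbf{Loc}$. Its initial object is the one-element lattice. The Zariski spectrum of a commutative ring $A$ is the locale $\mathrm{Spec}(A)$ whose opens are the radical ideals of $A$ ordered by inclusion. A homomorphism $f \colon A \to B$ of commutative rings induces a morphism $\mathrm{Spec}(B) \to \mathrm{Spec}(A)$ of locales, given by the function sending a radical ideal $I$ of $A$ to the radical of the ideal of $B$ generated by $f(I)$. *)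

(* Defs.v *)
From HB Require Import structures.
From mathcomp Require Import all_boot all_order all_algebra.
From mathcomp Require Import all_classical all_reals topology.
From mathcomp Require Export complex.

Set Implicit Arguments.
Unset Strict Implicit.
Unset Printing Implicit Defensive.
Import Order.TTheory GRing.Theory.
Local Open Scope classical_set_scope.
Local Open Scope ring_scope.

Record category := Category {
  obj :> Type;
  hom : obj -> obj -> Type;
  idm : forall a, hom a a;
  comp : forall a b c, hom b c -> hom a b -> hom a c;
  compA : forall a b c d (h : hom c d) (g : hom b c) (f : hom a b),
    comp h (comp g f) = comp (comp h g) f;
  comp1m : forall a b (f : hom a b), comp (idm b) f = f;
  compm1 : forall a b (f : hom a b), comp f (idm a) = f }.

Definition op (C : category) : category :=
  @Category C (fun a b => hom b a) (@idm C) (fun a b c g f => comp f g)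
    (fun a b c d h g f => esym (compA f g h))
    (fun a b f => compm1 f) (fun a b f => comp1m f).

Record functor (C D : category) := Functor {
  fobj :> C -> D;
  fmap : forall a b, hom a b -> hom (fobj a) (fobj b);
  fmap1 : forall a, fmap (idm a) = idm (fobj a);
  fmapM : forall a b c (g : hom b c) (f : hom a b),
    fmap (comp g f) = comp (fmap g) (fmap f) }.

Definition op_functor (C D : category) (F : functor C D) :
    functor (op C) (op D) :=
  @Functor (op C) (op D) F (fun a b f => fmap F f)
    (fun a => fmap1 F a) (fun a b c g f => fmapM F f g).

Lemma comp_fmap1 (C D E : category) (G : functor D E) (F : functor C D) a :
  fmap G (fmap F (idm a)) = idm (G (F a)).
Proof. by rewrite !fmap1. Qed.

Lemma comp_fmapM (C D E : category) (G : functor D E) (F : functor C D)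
    a b c (g : hom b c) (f : hom a b) :
  fmap G (fmap F (comp g f)) = comp (fmap G (fmap F g)) (fmap G (fmap F f)).
Proof. by rewrite !fmapM. Qed.

Definition comp_functor (C D E : category) (G : functor D E)
    (F : functor C D) : functor C E :=
  @Functor C E (fun a => G (F a)) (fun a b f => fmap G (fmap F f))
    (comp_fmap1 G F) (fun a b c g f => comp_fmapM G F g f).

Definition is_iso (C : category) (a b : C) (f : hom a b) : Prop :=
  exists g : hom b a, comp g f = idm a /\ comp f g = idm b.

Definition isomorphic (C : category) (a b : C) : Prop :=
  exists f : hom a b, is_iso f.

Definition is_initial (C : category) (a : C) : Prop :=
  forall b : C, exists! f : hom a b, True.

Definition naturally_isomorphic (C D : category) (F G : functor C D) : Prop :=
  exists eta : forall a : C, hom (F a) (G a),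
    (forall a b (f : hom a b),
       comp (eta b) (fmap F f) = comp (fmap G f) (eta a)) /\
    (forall a, is_iso (eta a)).

(* pzRingType and comPzRingType include the zero ring, and {rmorphism _ -> _}
   preserves 1. *)

Lemma rmorphism_ext (A B : pzRingType) (f g : {rmorphism A -> B}) :
  f =1 g -> f = g.
Proof.
case: f => f [[f1] [f2]]; case: g => g [[g1] [g2]] /= /funext fg.
by subst g; rewrite (Prop_irrelevance f1 g1) (Prop_irrelevance f2 g2).
Qed.

Definition rmorphism_id (A : pzRingType) : {rmorphism A -> A} := idfun.

Definition rmorphism_comp (A B C : pzRingType) (g : {rmorphism B -> C})
  (f : {rmorphism A -> B}) : {rmorphism A -> C} := g \o f.

Lemma rmorphism_compA (A B C D : pzRingType) (h : {rmorphism C -> D})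
    (g : {rmorphism B -> C}) (f : {rmorphism A -> B}) :
  rmorphism_comp h (rmorphism_comp g f) = rmorphism_comp (rmorphism_comp h g) f.
Proof. exact: rmorphism_ext. Qed.

Lemma rmorphism_comp1m (A B : pzRingType) (f : {rmorphism A -> B}) :
  rmorphism_comp (rmorphism_id B) f = f.
Proof. exact: rmorphism_ext. Qed.

Lemma rmorphism_compm1 (A B : pzRingType) (f : {rmorphism A -> B}) :
  rmorphism_comp f (rmorphism_id A) = f.
Proof. exact: rmorphism_ext. Qed.

Definition Ring : category :=
  @Category pzRingType (fun A B => {rmorphism A -> B})
    rmorphism_id rmorphism_comp
    rmorphism_compA rmorphism_comp1m rmorphism_compm1.

Definition cRing : category :=
  @Category comPzRingType (fun A B => {rmorphism A -> B})
    (fun A => rmorphism_id A) (fun A B C g f => rmorphism_comp g f)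
    (fun A B C D h g f => rmorphism_compA h g f)
    (fun A B f => rmorphism_comp1m f) (fun A B f => rmorphism_compm1 f).

Definition cRing_incl : functor cRing Ring :=
  @Functor cRing Ring (fun A : comPzRingType => A : pzRingType)
    (fun A B f => f) (fun A => erefl) (fun A B C g f => erefl).

(* The finite joins of tbLatticeType are implied by [bigjoin_sup], which states
   that [bigjoin A] is the least upper bound of [A]. *)
HB.mixin Record TBLattice_isLocale (d : Order.disp_t) (L : Type)
    of Order.TBLattice d L := {
  bigjoin : set L -> L;
  bigjoin_sup : forall A : set L, supremums A (bigjoin A);
  meet_bigjoin : forall (x : L) (A : set L),
    Order.meet x (bigjoin A) = bigjoin [set Order.meet x y | y in A] }.

#[short(type="localeType")]
HB.structure Definition Locale (d : Order.disp_t) :=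
  { L of Order.TBLattice d L & TBLattice_isLocale d L }.

(* The display of an order is a phantom tag used by notations only: all the
   objects of [Loc] share this one. *)
Fact locale_display : Order.disp_t. Proof. exact: Order.Disp tt tt. Qed.

Local Notation locale := (localeType locale_display).

(* A morphism of locales [K -> L] is a function from [L] to [K]. *)
Record locale_hom (K L : locale) := LocaleHom {
  inverse_image :> L -> K;
  inverse_image_top : inverse_image \top%O = \top%O;
  inverse_image_meet : forall x y : L,
    inverse_image (Order.meet x y) =
      Order.meet (inverse_image x) (inverse_image y);
  inverse_image_bigjoin : forall A : set L,
    inverse_image (bigjoin A) = bigjoin [set inverse_image x | x in A] }.

Lemma locale_hom_ext (K L : locale) (f g : locale_hom K L) : f =1 g -> f = g.
Proof.
case: f => f f1 f2 f3; case: g => g g1 g2 g3 /= /funext fg; subst g.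
by rewrite (Prop_irrelevance f1 g1) (Prop_irrelevance f2 g2)
  (Prop_irrelevance f3 g3).
Qed.

Definition locale_id (L : locale) : locale_hom L L :=
  @LocaleHom L L idfun erefl (fun _ _ => erefl)
    (fun A => f_equal (@bigjoin _ L) (esym (image_id A))).

Section LocaleComp.
Context (K L M : locale) (g : locale_hom L M) (f : locale_hom K L).

Lemma locale_comp_top : (f \o g) \top%O = \top%O.
Proof. by rewrite /= !inverse_image_top. Qed.

Lemma locale_comp_meet (x y : M) :
  (f \o g) (Order.meet x y) = Order.meet ((f \o g) x) ((f \o g) y).
Proof. by rewrite /= !inverse_image_meet. Qed.

Lemma locale_comp_bigjoin (A : set M) :
  (f \o g) (bigjoin A) = bigjoin [set (f \o g) x | x in A].
Proof. by rewrite /= !inverse_image_bigjoin image_comp. Qed.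

Definition locale_comp : locale_hom K M :=
  LocaleHom locale_comp_top locale_comp_meet locale_comp_bigjoin.

End LocaleComp.

Lemma locale_compA (K L M N : locale) (h : locale_hom M N)
    (g : locale_hom L M) (f : locale_hom K L) :
  locale_comp h (locale_comp g f) = locale_comp (locale_comp h g) f.
Proof. exact: locale_hom_ext. Qed.

Lemma locale_comp1m (K L : locale) (f : locale_hom K L) :
  locale_comp (locale_id L) f = f.
Proof. exact: locale_hom_ext. Qed.

Lemma locale_compm1 (K L : locale) (f : locale_hom K L) :
  locale_comp f (locale_id K) = f.
Proof. exact: locale_hom_ext. Qed.

Definition Loc : category :=
  @Category locale locale_hom locale_id locale_comp
    locale_compA locale_comp1m locale_compm1.

Section Opens.
Context (T : topologicalType).

Record opens := Opens { opens_set :> set T; _ : `[< open opens_set >] }.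

HB.instance Definition _ := [isSub of opens for opens_set].
HB.instance Definition _ := [Choice of opens by <:].
HB.instance Definition _ :=
  [SubChoice_isSubPOrder of opens by <: with locale_display].

Definition mk_opens (U : set T) (oU : open U) : opens := Opens (asboolT oU).

Lemma opens_open (U : opens) : open U.
Proof. by case: U => U /= /asboolP. Qed.

Lemma opens_leP (U V : opens) :
  reflect ((U : set T) `<=` (V : set T)) (U <= V)%O.
Proof. by rewrite leEsub; exact: subsetPset. Qed.

Definition opensI (U V : opens) : opens :=
  mk_opens (openI (opens_open U) (opens_open V)).

Definition opensU (U V : opens) : opens :=
  mk_opens (openU (opens_open U) (opens_open V)).

Definition opens_bigcup (A : set opens) : opens :=
  mk_opens (bigcup_open (fun (U : opens) (_ : A U) => opens_open U)).

Lemma opens_meetP (U V W : opens) :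
  (U <= opensI V W)%O = (U <= V)%O && (U <= W)%O.
Proof.
apply/opens_leP/andP => /= [|[/opens_leP UV /opens_leP UW]].
  by rewrite subsetI => -[UV UW]; split; exact/opens_leP.
by rewrite subsetI.
Qed.

Lemma opens_joinP (U V W : opens) :
  (opensU U V <= W)%O = (U <= W)%O && (V <= W)%O.
Proof.
apply/opens_leP/andP => /= [|[/opens_leP UV /opens_leP UW]].
  by rewrite subUset => -[UV UW]; split; exact/opens_leP.
by rewrite subUset.
Qed.

HB.instance Definition _ := Order.POrder_MeetJoin_isLattice.Build
  locale_display opens opens_meetP opens_joinP.

Lemma opens0_le (U : opens) : (mk_opens open0 <= U)%O.
Proof. exact/opens_leP. Qed.

Lemma opensT_ge (U : opens) : (U <= mk_opens openT)%O.
Proof. exact/opens_leP. Qed.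

HB.instance Definition _ :=
  Order.hasBottom.Build locale_display opens opens0_le.
HB.instance Definition _ := Order.hasTop.Build locale_display opens opensT_ge.

Lemma opens_bigcup_sup (A : set opens) : supremums A (opens_bigcup A).
Proof.
split=> [U AU|U leU]; apply/opens_leP => /=; first exact: bigcup_sup.
by apply: bigcup_sub => V AV; apply/opens_leP/leU.
Qed.

Lemma opensI_bigcup (U : opens) (A : set opens) :
  Order.meet U (opens_bigcup A) = opens_bigcup [set Order.meet U V | V in A].
Proof.
by apply: val_inj; rewrite /= setI_bigcupr bigcup_image.
Qed.

HB.instance Definition _ := TBLattice_isLocale.Build locale_display opens
  opens_bigcup_sup opensI_bigcup.

End Opens.

Definition opens_locale (T : topologicalType) : Loc := opens T.

Section VoidTopology.

Let op_void : set_system void := setT.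

Lemma op_voidI : setI_closed op_void. Proof. by []. Qed.

Lemma op_void_bigU (I : Type) (f : I -> set void) :
  (forall i, op_void (f i)) -> op_void (\bigcup_i f i).
Proof. by []. Qed.

HB.instance Definition _ :=
  isOpenTopological.Build void (I : op_void setT) op_voidI op_void_bigU.

End VoidTopology.

Section Ideals.
Context (A : comPzRingType).
Implicit Types (S I J K : set A).

Definition is_ideal I : Prop :=
  [/\ I 0, (forall x y, I x -> I y -> I (x + y))
    & (forall a x, I x -> I (a * x))].

Definition ideal_gen S : set A := smallest is_ideal S.

Definition radical I : set A := [set x | exists n : nat, I (x ^+ n)].

Definition is_radical_ideal I : Prop := is_ideal I /\ radical I `<=` I.

Lemma ideal_gen_ideal S : is_ideal (ideal_gen S).
Proof.
split=> [J [[]//]|x y Jx Jy J SJ|a x Jx J SJ]; have [[J0 JD JM] _] := SJ.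
- by apply: JD; [exact: Jx|exact: Jy].
- by apply: JM; exact: Jx.
Qed.

Lemma ideal_exp I x m n : is_ideal I -> (m <= n)%N -> I (x ^+ m) -> I (x ^+ n).
Proof. by move=> [_ _ IM] mn Ix; rewrite -(subnK mn) exprD; exact: IM. Qed.

Lemma sub_radical I : I `<=` radical I.
Proof. by move=> x Ix; exists 1%N. Qed.

Lemma radical_ideal I : is_ideal I -> is_radical_ideal (radical I).
Proof.
move=> iI; have [I0 ID IM] := iI; split.
  split=> [|x y [m Ix] [n Iy]|a x [n Ix]]; first exact: sub_radical.
    exists (m + n)%N; rewrite exprDn; apply: big_ind => [//|//|i _].
    rewrite -mulr_natl; apply: (IM).
    have [ni|/ltnW ni] := leqP n i.
      by apply: IM; exact: ideal_exp Iy.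
    rewrite mulrC; apply: IM; apply: (ideal_exp iI _ Ix).
    by rewrite -addnBA // leq_addr.
  by exists n; rewrite exprMn; exact: IM.
by move=> x [n [m]]; rewrite -exprM => Ix; exists (n * m)%N.
Qed.

Lemma idealI I J : is_ideal I -> is_ideal J -> is_ideal (I `&` J).
Proof.
move=> [I0 ID IM] [J0 JD JM]; split=> // [x y [Ix Jx] [Iy Jy]|a x [Ix Jx]].
  by split; [exact: ID|exact: JD].
by split; [exact: IM|exact: JM].
Qed.

Lemma radical_idealI I J :
  is_radical_ideal I -> is_radical_ideal J -> is_radical_ideal (I `&` J).
Proof.
move=> [iI rI] [iJ rJ]; split; first exact: idealI.
by move=> x [n [Ix Jx]]; split; [apply: rI|apply: rJ]; exists n.
Qed.

Lemma ideal_setT : is_radical_ideal setT. Proof. by []. Qed.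

Definition radical_gen S : set A := radical (ideal_gen S).

Lemma radical_gen_ideal S : is_radical_ideal (radical_gen S).
Proof. exact/radical_ideal/ideal_gen_ideal. Qed.

Lemma sub_radical_gen S : S `<=` radical_gen S.
Proof.
by move=> x Sx; apply: sub_radical; exact: (@sub_gen_smallest _ is_ideal).
Qed.

Lemma radical_gen_min S I :
  is_radical_ideal I -> S `<=` I -> radical_gen S `<=` I.
Proof.
by move=> [iI rI] SI x [n Sx]; apply: rI; exists n; exact: smallest_sub Sx.
Qed.

Lemma radical_genM S K (T : set A) x y :
    is_radical_ideal K ->
    (forall s t, S s -> T t -> K (s * t)) ->
  radical_gen S x -> radical_gen T y -> K (x * y).
Proof.
move=> [[K0 KD KM] rK] ST [m Sx] [n Ty]; apply: rK; exists (m + n)%N.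
rewrite exprMn !exprD (mulrC (x ^+ m)) mulrACA; apply: (KM).
pose KS : set A := [set a | forall t, T t -> K (a * t)].
have iKS : is_ideal KS.
  split=> [t _|a b Ka Kb t Tt|a b Kb t Tt]; rewrite ?mul0r ?mulrDl //.
    by apply: KD; [exact: Ka|exact: Kb].
  by rewrite -mulrA; apply: KM; exact: Kb.
have KSx : KS (x ^+ m) by apply: (smallest_sub iKS _ Sx) => s Ss t; exact: ST.
pose KT : set A := [set b | K (x ^+ m * b)].
have iKT : is_ideal KT.
  split=> [|a b Ka Kb|a b Kb]; rewrite /KT /= ?mulr0 ?mulrDr //; first exact: KD.
  by rewrite mulrCA; exact: KM.
exact: (smallest_sub iKT KSx Ty).
Qed.

End Ideals.

Section Zariski.
Context (A : comPzRingType).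

Record zariski := Zariski {
  zariski_set :> set A;
  _ : `[< is_radical_ideal zariski_set >] }.

HB.instance Definition _ := [isSub of zariski for zariski_set].
HB.instance Definition _ := [Choice of zariski by <:].
HB.instance Definition _ :=
  [SubChoice_isSubPOrder of zariski by <: with locale_display].

Definition mk_zariski (I : set A) (rI : is_radical_ideal I) : zariski :=
  Zariski (asboolT rI).

Lemma zariskiP (I : zariski) : is_radical_ideal I.
Proof. by case: I => I /= /asboolP. Qed.

Lemma zariski_leP (I J : zariski) :
  reflect ((I : set A) `<=` (J : set A)) (I <= J)%O.
Proof. by rewrite leEsub; exact: subsetPset. Qed.

Definition zariskiI (I J : zariski) : zariski :=
  mk_zariski (radical_idealI (zariskiP I) (zariskiP J)).

Definition zariskiU (I J : zariski) : zariski :=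
  mk_zariski (radical_gen_ideal ((I : set A) `|` (J : set A))).

Definition zariski_bigjoin (X : set zariski) : zariski :=
  mk_zariski (radical_gen_ideal (\bigcup_(I in X) (I : set A))).

Lemma zariski_meetP (I J K : zariski) :
  (I <= zariskiI J K)%O = (I <= J)%O && (I <= K)%O.
Proof.
apply/zariski_leP/andP => /= [|[/zariski_leP IJ /zariski_leP IK]].
  by rewrite subsetI => -[IJ IK]; split; exact/zariski_leP.
by rewrite subsetI.
Qed.

Lemma zariski_joinP (I J K : zariski) :
  (zariskiU I J <= K)%O = (I <= K)%O && (J <= K)%O.
Proof.
apply/zariski_leP/andP => /= [IJK|[/zariski_leP IK /zariski_leP JK]].
  by split; apply/zariski_leP => x Hx; apply/IJK/sub_radical_gen; [left|right].
by apply: radical_gen_min; [exact: zariskiP|rewrite subUset].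
Qed.

HB.instance Definition _ := Order.POrder_MeetJoin_isLattice.Build
  locale_display zariski zariski_meetP zariski_joinP.

Lemma zariski0_le (I : zariski) : (mk_zariski (radical_gen_ideal set0) <= I)%O.
Proof. apply/zariski_leP; apply: radical_gen_min => //; exact: zariskiP. Qed.

Lemma zariskiT_ge (I : zariski) : (I <= mk_zariski (ideal_setT A))%O.
Proof. exact/zariski_leP. Qed.

HB.instance Definition _ :=
  Order.hasBottom.Build locale_display zariski zariski0_le.
HB.instance Definition _ :=
  Order.hasTop.Build locale_display zariski zariskiT_ge.

Lemma zariski_bigjoin_sup (X : set zariski) : supremums X (zariski_bigjoin X).
Proof.
split=> [I XI|I leI]; apply/zariski_leP => /=.
  by move=> x Ix; apply: sub_radical_gen; exists I.
apply: radical_gen_min; first exact: zariskiP.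
by apply: bigcup_sub => J XJ; apply/zariski_leP/leI.
Qed.

Lemma zariskiI_bigjoin (I : zariski) (X : set zariski) :
  Order.meet I (zariski_bigjoin X) =
    zariski_bigjoin [set Order.meet I J | J in X].
Proof.
apply: val_inj => /=; rewrite bigcup_image; apply/seteqP; split=> x.
  move=> [Ix Xx]; have [_] := radical_gen_ideal
    (\bigcup_(J in X) (Order.meet I J : set A)); apply; exists 2%N.
  rewrite expr2.
  apply: radical_genM (sub_radical_gen Ix) Xx; first exact: radical_gen_ideal.
  have [[_ _ IM] _] := zariskiP I.
  move=> s t Is [J XJ Jt]; have [[_ _ JM] _] := zariskiP J.
  apply: sub_radical_gen; exists J => //; split; last exact: JM.
  by rewrite mulrC; exact: IM.
apply: radical_gen_min => /=.
  by apply: radical_idealI; [exact: zariskiP|exact: radical_gen_ideal].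
move=> y [J XJ [Iy Jy]]; split=> //.
by apply: sub_radical_gen; exists J.
Qed.

HB.instance Definition _ := TBLattice_isLocale.Build locale_display zariski
  zariski_bigjoin_sup zariskiI_bigjoin.

End Zariski.

Section ZariskiMap.
Context (A B : comPzRingType) (f : {rmorphism A -> B}).

Definition zariski_map (I : zariski A) : zariski B :=
  mk_zariski (radical_ideal (ideal_gen_ideal (f @` I))).

Lemma zariski_map_sub (I : zariski A) (J : set B) : is_radical_ideal J ->
  (zariski_map I : set B) `<=` J <-> (forall x, (I : set A) x -> J (f x)).
Proof.
move=> rJ; split=> [fIJ x Ix|IJ].
  by apply/fIJ/sub_radical_gen; exists x.
by apply: radical_gen_min => // _ [x Ix <-]; exact: IJ.
Qed.

Lemma zariski_map_in (I : zariski A) x :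
  (I : set A) x -> (zariski_map I : set B) (f x).
Proof. by move=> Ix; apply: sub_radical_gen; exists x. Qed.

Lemma zariski_map_top : zariski_map \top%O = \top%O.
Proof.
apply: val_inj; apply/seteqP; split=> // x _.
have [[_ _ JM] _] := zariskiP (zariski_map \top%O).
rewrite -(mulr1 x); apply: JM; rewrite -(rmorph1 f).
exact: zariski_map_in.
Qed.

Lemma zariski_map_meet (I J : zariski A) :
  zariski_map (Order.meet I J) = Order.meet (zariski_map I) (zariski_map J).
Proof.
apply: val_inj; apply/seteqP; split.
  apply/zariski_map_sub; first exact: zariskiP.
  by move=> x [Ix Jx]; split; exact: zariski_map_in.
move=> x [Ix Jx]; have [_] := zariskiP (zariski_map (Order.meet I J)).
apply; exists 2%N; rewrite expr2.
apply: radical_genM Ix Jx; first exact: zariskiP.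
move=> _ _ [s Is <-] [t Jt <-]; rewrite -rmorphM; apply: zariski_map_in.
have [[_ _ IM] _] := zariskiP I; have [[_ _ JM] _] := zariskiP J.
by split; [rewrite mulrC; exact: IM|exact: JM].
Qed.

Lemma zariski_map_bigjoin (X : set (zariski A)) :
  zariski_map (bigjoin X) = bigjoin [set zariski_map I | I in X].
Proof.
apply/eqP; rewrite eq_le; apply/andP; split; last first.
  have [_] := bigjoin_sup [set zariski_map I | I in X]; apply.
  move=> _ [I XI <-]; apply/zariski_leP.
  apply/zariski_map_sub; first exact: zariskiP.
  move=> x Ix; apply: zariski_map_in.
  have [+ _] := bigjoin_sup X => /(_ I XI)/zariski_leP; exact.
apply/zariski_leP/zariski_map_sub; first exact: zariskiP.
set J := bigjoin [set _ | _ in _].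
have [[J0 JD JM] rJ] := zariskiP J.
suff /(_ _)/zariski_leP : (bigjoin X <= mk_zariski
  (_ : is_radical_ideal [set x | (J : set B) (f x)]))%O.
  move=> h x Xx; apply: (h _ x Xx).
  split; last by move=> x' [n]; rewrite /= rmorphXn => Jx; apply: rJ; exists n.
  split=> [|a b Ja Jb|a b Jb]; rewrite /= ?rmorph0 ?rmorphD ?rmorphM //.
    exact: JD.
  exact: JM.
move=> rI; have [_] := bigjoin_sup X; apply => I XI; apply/zariski_leP => x Ix.
have [+ _] := bigjoin_sup [set zariski_map I | I in X].
move=> /(_ (zariski_map I)) /= h.
have /zariski_leP := h (ex_intro2 _ _ I XI erefl).
by apply; exact: zariski_map_in.
Qed.

Definition Spec_map :
    locale_hom (zariski B : localeType _) (zariski A : localeType _) :=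
  LocaleHom zariski_map_top zariski_map_meet zariski_map_bigjoin.

End ZariskiMap.

Lemma Spec_map1 (A : comPzRingType) :
  Spec_map (rmorphism_id A) = locale_id (zariski A).
Proof.
apply: locale_hom_ext => I; apply: val_inj; apply/seteqP; split.
  by apply/zariski_map_sub; first exact: zariskiP.
by move=> x Ix; exact: (@zariski_map_in _ _ (rmorphism_id A)).
Qed.

Lemma Spec_mapM (A B C : comPzRingType) (g : {rmorphism B -> C})
    (f : {rmorphism A -> B}) :
  Spec_map (rmorphism_comp g f) = locale_comp (Spec_map f) (Spec_map g).
Proof.
apply: locale_hom_ext => I; apply: val_inj; apply/seteqP; split.
  apply/zariski_map_sub; first exact: zariskiP.
  by move=> x Ix; do 2!apply: zariski_map_in.
apply/zariski_map_sub; first exact: zariskiP.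
set J := zariski_map (rmorphism_comp g f) I.
have [[J0 JD JM] rJ] := zariskiP J.
suff : (zariski_map f I : set B) `<=` [set y | (J : set C) (g y)] by [].
apply/zariski_map_sub.
  split; last by move=> x' [n]; rewrite /= rmorphXn => Jx; apply: rJ; exists n.
  split=> [|a b Ja Jb|a b Jb]; rewrite /= ?rmorph0 ?rmorphD ?rmorphM //.
    exact: JD.
  exact: JM.
by move=> x Ix; exact: (@zariski_map_in _ _ (rmorphism_comp g f)).
Qed.

Definition Spec : functor (op cRing) Loc :=
  @Functor (op cRing) Loc
    (fun A : comPzRingType => zariski A : localeType locale_display)
    (fun A B f => Spec_map f) Spec_map1
    (fun A B C g f => Spec_mapM f g).

(* Main.v *)
Require Import Defs.
From HB Require Import structures.
From mathcomp Require Import all_boot all_order all_algebra.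
From mathcomp Require Import all_classical all_reals topology.

(** Write M for the matrix ring and L for G(M). Every ring map f : B -> M with
    B commutative gives a frame map theta_f from the radical ideals of B to L,
    by naturality compatible with precomposition. Hence each a in M has a
    well-defined open in L: pull back the basic open D(X) along the map
    Z[X] -> M sending X to a ([open_of], [theta_basic_open]). Two orthogonal
    idempotents of M come from a map Z^3 -> M, and so computing in
    Spec(Z^3) shows that this assignment phi takes 1 to the top, orthogonal
    idempotents to disjoint opens, and their sum to the join
    ([open_of_valuation]).

    The rest is a Kochen-Specker argument carried out inside L, which therefore
    needs no points of L. All idempotents are available, not just the
    self-adjoint ones, and this allows a coordinate-free proof. For a column
    a and a row x with x a = 1 let h(a, x) = phi(a x); here a is a point of the
    affine space cut out by x. If x b = 0, y b = 1 and y a = -1, then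
    a x + b (y + x) = (a + b) x + b y, both sides being sums of orthogonal
    idempotents, and so h(a, x) <= h(a + b, x) \/ h(b, y) ([rank_one_shear]);
    the same holds with rows and columns exchanged. From these two inequalities
    and disjointness, h(a, x) does not depend on a ([shear_le]) nor, dually, on
    x; the proof uses a vector independent of a and b, which exists when
    n >= 3. Thus h takes the same value on two orthogonal rank-one idempotents,
    hence the value bottom ([rank_one_eq0]). The identity matrix is a sum of orthogonal rank-one
    idempotents, so top = bottom in L ([valuation_mx_trivial]), and a locale in
    which top = bottom is initial ([trivial_initial]). *)

Set Implicit Arguments.
Unset Strict Implicit.
Unset Printing Implicit Defensive.
Import GRing.Theory Order.TTheory.
Local Open Scope ring_scope.

(** * Finite distributivity and initial objects of locales *)

Section LocaleTheory.
Context {d : Order.disp_t} {L : localeType d}.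
Implicit Types x y z : L.

Lemma join_bigjoin x y : (x `|` y)%O = bigjoin [set x; y]%classic.
Proof.
have [ub lub] := bigjoin_sup [set x; y]%classic.
apply/eqP; rewrite eq_le leUx; apply/andP; split.
  by apply/andP; split; apply: ub; [left|right].
by apply: lub => _ [->|->]; rewrite ?leUl ?leUr.
Qed.

Lemma bottom_bigjoin : \bot%O = bigjoin (set0 : set L).
Proof.
have [_ lub] := bigjoin_sup (set0 : set L).
by apply/eqP; rewrite eq_le le0x; apply: lub.
Qed.

Lemma locale_meetUr x y z : (x `&` (y `|` z) = (x `&` y) `|` (x `&` z))%O.
Proof. by rewrite !join_bigjoin meet_bigjoin image_setU !image_set1. Qed.

(** The cut rule, reading x, y, z and w as propositions of a sequent. *)
Lemma le_join_cut x y z w : (x <= w `|` z -> x `&` w <= y -> x <= y `|` z)%O.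
Proof.
move=> xwz xwy; rewrite -(meet_idPl xwz) locale_meetUr leUx.
by rewrite (le_trans xwy) ?leUl // leIxr // leUr.
Qed.

Lemma le_joinI x y z w :
  (x <= y `|` z -> x <= y `|` w -> x <= y `|` (z `&` w))%O.
Proof.
move=> xyz xyw; rewrite -(meet_idPl xyz) locale_meetUr leUx lexUl ?leIr //=.
rewrite -{1}(meet_idPl xyw) meetAC locale_meetUr leUx.
by rewrite lexUl ?leIr // lexUr // lexI leIr leIxl ?leIr.
Qed.

End LocaleTheory.

Section LocaleHom.
Context {K L : localeType locale_display} (f : locale_hom K L).

Lemma locale_hom0 : f \bot%O = \bot%O.
Proof. by rewrite !bottom_bigjoin inverse_image_bigjoin image_set0. Qed.

Lemma locale_homU x y : f (x `|` y)%O = (f x `|` f y)%O.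
Proof. by rewrite !join_bigjoin inverse_image_bigjoin image_setU !image_set1. Qed.

End LocaleHom.

Lemma trivial_initial (L : localeType locale_display) :
  \bot%O = \top%O :> L -> is_initial (L : Loc).
Proof.
move=> L0 M; have all_eq (x y : L) : x = y.
  have top (z : L) : z = \top%O by apply/eqP; rewrite eq_le lex1 -L0 le0x.
  by rewrite (top x) (top y).
unshelve eexists.
  by exists (fun=> \top%O) => *; exact: all_eq.
by split=> // g _; apply: locale_hom_ext => x; exact: all_eq.
Qed.

Lemma initial_isomorphic (C : category) (a b : C) :
  is_initial a -> is_initial b -> isomorphic a b.
Proof.
move=> ia ib; have [f _] := ia b; have [g _] := ib a.
have [h [_ hu]] := ia a; have [k [_ ku]] := ib b.
exists f, g; split.
  by rewrite -(hu (Defs.comp g f) I) (hu (idm a) I).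
by rewrite -(ku (Defs.comp f g) I) (ku (idm b) I).
Qed.

(** * A Kochen-Specker argument for dual pairs *)

Section Pairings.
Context {d : Order.disp_t} {L : localeType d} {U : pzRingType}.

Section Definitions.
Context {V W : zmodType} (p : W -> V -> U) (h : V -> W -> L).

(** A product in [Type], as is [dual_triples], so that a proof serves as a
    rewriting multirule. *)
Definition biadditive : Type :=
  ((forall v, {morph p^~ v : x y / (x + y)%R}) *
   (forall x, {morph p x : v w / (v + w)%R}))%type.

Definition dual_triples (a b c : V) (x y z : W) : Type :=
  (((p x a = 1%R) * (p x b = 0%R) * (p x c = 0%R)) *
   ((p y a = 0%R) * (p y b = 1%R) * (p y c = 0%R)) *
   ((p z a = 0%R) * (p z b = 0%R) * (p z c = 1%R)))%type.

Definition exclusive : Prop := forall a b x y,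
  p x a = 1 -> p x b = 0 -> p y a = 0 -> p y b = 1 ->
  (h a x `&` h b y)%O = \bot%O.

Definition shear_law : Prop := forall a b x y,
  p x a = 1 -> p x b = 0 -> p y a = -1 -> p y b = 1 ->
  (h a x <= h (a + b) x `|` h b y)%O.

End Definitions.

(** Exchanging vectors and covectors: each statement about [p] and [h] has a dual
    one about [flip p] and [flip h]. *)
Definition flip {S T X : Type} (f : S -> T -> X) : T -> S -> X :=
  fun t s => f s t.

Lemma biadditive_flip {V W : zmodType} (p : W -> V -> U) :
  biadditive p -> biadditive (flip p).
Proof. by case. Qed.

Lemma exclusive_flip {V W : zmodType} (p : W -> V -> U) h :
  exclusive p h -> exclusive (flip p) (flip h).
Proof. by move=> ex x y a b xa ya xb yb; exact: ex. Qed.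

Lemma biadditiveN {V W : zmodType} (p : W -> V -> U) : biadditive p ->
  ((forall x v, p (- x)%R v = (- p x v)%R) *
   (forall x v, p x (- v)%R = (- p x v)%R))%type.
Proof.
move=> [pDl pDr]; split=> x v.
  have p0 : p 0 v = 0 by apply: (addrI (p 0 v)); rewrite -pDl !addr0.
  by apply: (addrI (p x v)); rewrite -pDl !subrr.
have p0 : p x 0 = 0 by apply: (addrI (p x 0)); rewrite -pDr !addr0.
by apply: (addrI (p x v)); rewrite -pDr !subrr.
Qed.

Ltac pairing_by pD D :=
  repeat split; rewrite /flip ?pD ?(biadditiveN pD) ?D;
  by rewrite ?(oppr0, addr0, add0r, opprK, subrr, addNr).

Lemma dual_triples_flip {V W : zmodType} (p : W -> V -> U) a b c x y z :
  dual_triples p a b c x y z -> dual_triples (flip p) x y z a b c.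
Proof. by move=> D; repeat split; rewrite /flip D. Qed.

(** Shearing l + b back to l by - b leaves only h (- b) (- y) as an alternative
    to h l x, and shearing l + c back leaves only h (- c) (- z). These two are
    disjoint. *)
Lemma exchange_le {V W : zmodType} (p : W -> V -> U) h l b c x y z :
  biadditive p -> exclusive p h -> shear_law p h ->
  dual_triples p l b c x y z ->
  (h (l + b) x `&` h (l + c) x <= h l x)%O.
Proof.
move=> pD ex sh D.
have hb : (h (l + b) x <= h l x `|` h (- b)%R (- y)%R)%O.
  by rewrite -{2}(addrK b l); apply: sh; pairing_by pD D.
have hc : (h (l + c) x <= h l x `|` h (- c)%R (- z)%R)%O.
  by rewrite -{2}(addrK c l); apply: sh; pairing_by pD D.
rewrite -[leRHS]joinx0 -(ex (- b) (- c) (- y) (- z)); try by pairing_by pD D.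
by apply: le_joinI; [apply: leIxl|apply: leIxr].
Qed.

(** It is enough that h a x lies below h (a + b) x joined with h b y, and below
    h (a + b) x joined with h c z, since h b y and h c z are disjoint. The shear
    law gives such bounds with covectors r equal to -1 on a in place of y and z.
    Two choices of r and the dual of [exchange_le] then reach y and z, which
    vanish on a. *)
Lemma shear_le {V W : zmodType} (p : W -> V -> U) h a b c x y z :
  biadditive p -> exclusive p h -> shear_law p h ->
  shear_law (flip p) (flip h) ->
  dual_triples p a b c x y z -> (h a x <= h (a + b) x)%O.
Proof.
move=> pD ex sh shf D.
have dual_exchange v w s t u r : dual_triples p v w s t u r ->
    (h a x <= h (a + b) x `|` h v (t + u))%O ->
    (h a x <= h (a + b) x `|` h v (t + r))%O ->
    (h a x <= h (a + b) x `|` h v t)%O.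
  move=> /dual_triples_flip D' hu hr; apply: le_trans (le_joinI hu hr) _.
  rewrite leU2 //.
  exact: exchange_le (biadditive_flip pD) (exclusive_flip ex) shf D'.
have inb r : p r a = -1 -> p r b = 1 -> (h a x <= h (a + b) x `|` h b r)%O.
  by move=> ra rb; apply: sh => //; pairing_by pD D.
(* The shear law along c yields h (a + c) x in place of h (a + b) x. On h a x the
   first lies below the second, because a, a + b and a + c are not collinear. *)
have inc r : p r a = -1 -> p r c = 1 -> (h a x <= h (a + b) x `|` h c r)%O.
  move=> ra rc; apply: (@le_join_cut _ _ _ _ _ (h (a + c) x)).
    by apply: sh => //; pairing_by pD D.
  (* From a + b, the points a and a + c are reached by - b and c - b. *)
  have D' : dual_triples p (a + b) (- b) (c - b) x (x - y - z) z.
    by pairing_by pD D.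
  have := exchange_le pD ex sh D'.
  by rewrite addrK [c - b]addrC addrA addrK.
have hb : (h a x <= h (a + b) x `|` h b y)%O.
  apply: (@dual_exchange b (- a - c) c y (- x) (z - x)).
  - by pairing_by pD D.
  - by apply: inb; pairing_by pD D.
  - by apply: inb; pairing_by pD D.
have hc : (h a x <= h (a + b) x `|` h c z)%O.
  apply: (@dual_exchange c (- a - b) b z (- x) (y - x)).
  - by pairing_by pD D.
  - by apply: inc; pairing_by pD D.
  - by apply: inc; pairing_by pD D.
rewrite -[leRHS]joinx0 -(ex b c y z); try by pairing_by pD D.
exact: le_joinI.
Qed.

(** The covector x is moved to y through the intermediate vector a + b, which
    pairs to 1 with both; so h a x <= h b y, and these two are disjoint. *)
Lemma rank_one_eq0 {V W : zmodType} (p : W -> V -> U) h a b c x y z :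
  biadditive p -> exclusive p h -> shear_law p h ->
  shear_law (flip p) (flip h) ->
  dual_triples p a b c x y z -> h a x = \bot%O.
Proof.
move=> pD ex sh shf D.
suff ab : (h a x <= h b y)%O.
  by rewrite -(ex a b x y) ?D // (meet_idPl ab).
apply: le_trans (shear_le pD ex sh shf D) _.
have D1 : dual_triples (flip p) x (y - x) z (a + b) b c by pairing_by pD D.
have := shear_le (biadditive_flip pD) (exclusive_flip ex) shf sh D1.
rewrite /flip (addrC x) subrK => /le_trans; apply.
have D2 : dual_triples p (a + b) (- a) c y (y - x) z by pairing_by pD D.
by have := shear_le pD ex sh shf D2; rewrite addrAC subrr add0r.
Qed.

End Pairings.

(** * Valuations on the idempotents of a matrix ring *)

Definition orth_idempotents (A : pzRingType) (e f : A) : Prop :=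
  [/\ e * e = e, f * f = f, e * f = 0 & f * e = 0].

(** Restricted to idempotents, such a [phi] is a morphism of partial Boolean
    algebras into the complemented elements of [L]. Taking it total on [A] avoids
    a subtype of idempotents. *)
Record idempotent_valuation (d : Order.disp_t) (L : localeType d)
    (A : pzRingType) (phi : A -> L) : Prop := IdempotentValuation {
  valuation1 : phi 1 = \top%O;
  valuation_meet : forall e f, orth_idempotents e f ->
    (phi e `&` phi f)%O = \bot%O;
  valuationD : forall e f, orth_idempotents e f ->
    phi (e + f) = (phi e `|` phi f)%O }.

Section MatrixValuations.
Context {d : Order.disp_t} {L : localeType d} {K : pzRingType} {n : nat}.
Context {phi : 'M[K]_n -> L} (phiP : idempotent_valuation phi).

Let pairing (w : 'rV[K]_n) (v : 'cV[K]_n) : 'M[K]_1 := w *m v.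
Let rank_one (v : 'cV[K]_n) (w : 'rV[K]_n) : L := phi (v *m w).

Lemma rank_one_orth a b x y :
  pairing x a = 1 -> pairing x b = 0 -> pairing y a = 0 -> pairing y b = 1 ->
  orth_idempotents (a *m x) (b *m y).
Proof.
have mul3 (u v : 'cV[K]_n) (s t : 'rV[K]_n) :
    (u *m s) * (v *m t) = u *m pairing s v *m t.
  by rewrite -mulmxE /pairing !mulmxA.
move=> xa xb ya yb.
by split; rewrite mul3 ?xa ?xb ?ya ?yb ?mulmx0 ?mul0mx // mulmx1.
Qed.

Lemma pairing_biadditive : biadditive pairing.
Proof. by split=> [v x y|x v w]; [exact: mulmxDl|exact: mulmxDr]. Qed.

Lemma rank_one_exclusive : exclusive pairing rank_one.
Proof. by move=> a b x y *; apply/(valuation_meet phiP)/rank_one_orth. Qed.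

(** a x + b (y + x) = (a + b) x + b y, and both sides are sums of orthogonal
    idempotents. *)
Lemma rank_one_shear : shear_law pairing rank_one.
Proof.
move=> a b x y xa xb ya yb; have pD := pairing_biadditive.
rewrite /rank_one -(valuationD phiP); last first.
  by apply: rank_one_orth; rewrite ?pD ?xa ?xb ?ya ?yb ?addr0 ?addNr.
rewrite mulmxDl -addrA -mulmxDr (valuationD phiP) ?leUl //.
by apply: rank_one_orth; rewrite ?pD ?xa ?xb ?ya ?yb ?subrr ?add0r.
Qed.

(** a x + (b + a) y = a (x + y) + b y, and both sides are sums of orthogonal
    idempotents. *)
Lemma rank_one_shear_flip : shear_law (flip pairing) (flip rank_one).
Proof.
move=> x y a b; rewrite /flip => xa ya xb yb; have pD := pairing_biadditive.
rewrite /rank_one -(valuationD phiP); last first.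
  by apply: rank_one_orth; rewrite ?pD ?xa ?xb ?ya ?yb ?addr0 ?addNr.
rewrite mulmxDr -addrA -mulmxDl (valuationD phiP) ?leUl //.
by apply: rank_one_orth; rewrite ?pD ?xa ?xb ?ya ?yb ?subrr ?add0r.
Qed.

Lemma valuation_diag0 i : (3 <= n)%N -> phi (delta_mx i i) = \bot%O.
Proof.
move=> n3.
have /card_gt1P[j [k [ij ik jk]]] : (1 < #|predC1 i|)%N.
  by rewrite cardC1 card_ord -subn1 ltn_subRL.
have D : dual_triples pairing (delta_mx i 0) (delta_mx j 0) (delta_mx k 0)
    (delta_mx 0 i) (delta_mx 0 j) (delta_mx 0 k).
  have pE s t : pairing (delta_mx 0 s) (delta_mx t 0) = (s == t)%:R.
    rewrite /pairing mul_delta_mx_cond; congr (_ *+ _).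
    by apply/matrixP => a b; rewrite !ord1 !mxE.
  rewrite !inE in ij ik.
  by repeat split; rewrite pE ?eqxx // 1?eq_sym
    ?(negPf ij, negPf ik, negPf jk) // eq_sym
    ?(negPf ij, negPf ik, negPf jk).
have := rank_one_eq0 pairing_biadditive rank_one_exclusive rank_one_shear
  rank_one_shear_flip D.
by rewrite /rank_one mul_delta_mx.
Qed.

(** A valuation that vanishes on the diagonal matrix units vanishes on their sum,
    the identity. *)
Lemma valuation_mx_trivial : (3 <= n)%N -> \bot%O = \top%O :> L.
Proof.
move=> n3; rewrite -(valuation1 phiP).
rewrite -[1]/(1%:M) mx1_sum_delta.
pose E (s : seq 'I_n) : 'M[K]_n := \sum_(i <- s) delta_mx i i.
have deltaE i j :
    delta_mx i i * delta_mx j j = delta_mx i j *+ (i == j) :> 'M[K]_n.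
  exact: mul_delta_mx_cond.
suff h s : uniq s -> E s * E s = E s /\ phi (E s) = \bot%O.
  by case: (h (index_enum _) (index_enum_uniq _)).
elim: s => [_|i s IH /= /andP[si us]].
  rewrite /E big_nil mul0r; split=> //.
  rewrite -[LHS]meetxx; apply: (valuation_meet phiP).
  by split; rewrite mul0r.
have [EE E0] := IH us.
have o : orth_idempotents (delta_mx i i) (E s).
  split=> //; first by rewrite deltaE eqxx.
    rewrite mulr_sumr big_seq big1 // => j js; rewrite deltaE.
    by case: eqP si => // ->; rewrite js.
  rewrite mulr_suml big_seq big1 // => j js; rewrite deltaE.
  by case: eqP si => // <-; rewrite js.
have -> : E (i :: s) = delta_mx i i + E s by rewrite /E big_cons.
split.
  by case: o => ee ff ef fe; rewrite mulrDl !mulrDr ee ff ef fe addr0 add0r.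
by rewrite (valuationD phiP o) E0 valuation_diag0 // joinxx.
Qed.

End MatrixValuations.

(** * Basic opens of the Zariski spectrum *)

Section BasicOpens.
Context {B : comPzRingType}.
Implicit Types (x y : B) (I : zariski B).

Definition basic_open x : zariski B :=
  mk_zariski (radical_gen_ideal [set x]%classic).

Lemma basic_open_le x I : (basic_open x <= I)%O <-> (I : set B) x.
Proof.
split=> [/zariski_leP|Ix]; first by apply; exact: sub_radical_gen.
apply/zariski_leP; apply: radical_gen_min; first exact: zariskiP.
by move=> _ ->.
Qed.

Lemma basic_open_in x : (basic_open x : set B) x.
Proof. exact/basic_open_le. Qed.

Lemma basic_open1 : basic_open 1 = \top%O.
Proof.
apply: val_inj; apply/seteqP; split=> // x _.
have [[_ _ IM] _] := zariskiP (basic_open 1).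
by rewrite -[x]mulr1; apply: IM; exact: basic_open_in.
Qed.

Lemma basic_open_meet0 x y : x * y = 0 ->
  (basic_open x `&` basic_open y)%O = \bot%O.
Proof.
move=> xy0; apply/eqP; rewrite -lex0; apply/zariski_leP => z [xz yz].
have rI := zariskiP (\bot%O : zariski B); have [[I0 _ _] rad] := rI.
apply: rad; exists 2%N; rewrite expr2.
by apply: radical_genM xz yz => // _ _ -> ->; rewrite xy0.
Qed.

Lemma basic_openD x y : x * y = 0 ->
  basic_open (x + y) = (basic_open x `|` basic_open y)%O.
Proof.
move=> xy0; apply/eqP; rewrite eq_le leUx; apply/and3P; split.
- apply/basic_open_le; have [[_ ID _] _] :=
    zariskiP (basic_open x `|` basic_open y)%O.
  by apply: ID; apply/basic_open_le; rewrite ?leUl ?leUr.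
- apply/basic_open_le; have [[_ _ IM] rad] := zariskiP (basic_open (x + y)).
  apply: rad; exists 2%N; rewrite expr2 -[x * x]addr0 -xy0 -mulrDr.
  by apply: IM; exact: basic_open_in.
apply/basic_open_le; have [[_ _ IM] rad] := zariskiP (basic_open (x + y)).
apply: rad; exists 2%N; rewrite expr2 -[y * y]add0r -xy0 (mulrC x) -mulrDr.
by apply: IM; exact: basic_open_in.
Qed.

End BasicOpens.

Lemma radical_ideal_preimage (B C : comPzRingType) (f : {rmorphism B -> C})
    (I : set C) :
  is_radical_ideal I -> is_radical_ideal (f @^-1` I)%classic.
Proof.
move=> [[I0 ID IM] rad]; split; last first.
  by move=> x [n]; rewrite /= rmorphXn => Ix; apply: rad; exists n.
by split=> [|x y Ix Iy|x y Iy]; rewrite /= ?rmorph0 ?rmorphD ?rmorphM //;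
  [exact: ID|exact: IM].
Qed.

Lemma Spec_map_basic_open (B C : comPzRingType) (f : {rmorphism B -> C}) x :
  Spec_map f (basic_open x) = basic_open (f x).
Proof.
apply/eqP; rewrite eq_le; apply/andP; split; last first.
  by apply/basic_open_le/zariski_map_in; exact: basic_open_in.
apply/zariski_leP/zariski_map_sub; first exact: zariskiP.
apply: radical_gen_min; first exact/radical_ideal_preimage/zariskiP.
by move=> _ ->; exact: basic_open_in.
Qed.

(** * Opens attached to the elements of a noncommutative ring *)

Section IntegerEvaluation.
Context {A : nzRingType}.

Lemma intr_commutes (a : A) : commr_rmorph (intr : int -> A) a.
Proof. by move=> n; exact: commr_int. Qed.

Definition int_eval (a : A) : {rmorphism {poly int} -> A} :=
  horner_morph (intr_commutes a).

Lemma int_evalX a : int_eval a 'X = a.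
Proof. exact: horner_morphX. Qed.

Lemma int_poly_rmorph_ext (f g : {rmorphism {poly int} -> A}) :
  f 'X = g 'X -> f = g.
Proof.
move=> fg; apply: rmorphism_ext => q; elim/poly_ind: q => [|q c IH].
  by rewrite !rmorph0.
by rewrite !rmorphD !rmorphM IH fg -[c]intz (rmorph_int polyC) !rmorph_int.
Qed.

End IntegerEvaluation.

Section SplitMap.
Context {A : pzRingType} (e f : A).

(** The proof of orthogonality is an argument so that the ring morphism structure
    can be attached to [split_map]. *)
Definition split_map of orth_idempotents e f : int * int * int -> A :=
  fun z => e *~ z.1.1 + f *~ z.1.2 + (1 - e - f) *~ z.2.

Context (o : orth_idempotents e f).

Fact split_map_zmod_morphism : zmod_morphism (split_map o).
Proof.
move=> x y; rewrite /split_map; set g := 1 - e - f.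
by rewrite /= !mulrzBr !opprD [RHS]addrACA; congr (_ + _); rewrite addrACA.
Qed.

Fact split_map_monoid_morphism : monoid_morphism (split_map o).
Proof.
have [ee ff ef fe] := o.
set g := 1 - e - f.
have eg : e * g = 0 by rewrite !mulrBr mulr1 ee ef subrr subr0.
have ge : g * e = 0 by rewrite !mulrBl mul1r ee fe subrr subr0.
have fg : f * g = 0 by rewrite !mulrBr mulr1 ff fe subr0 subrr.
have gf : g * f = 0 by rewrite !mulrBl mul1r ff ef subr0 subrr.
have gg : g * g = g by rewrite {1}/g !mulrBl mul1r eg fg !subr0.
split.
  have gE : g = 1 - (e + f) by rewrite opprD addrA.
  by rewrite /split_map -/g /= !mulr1z gE addrC subrK.
move=> x y; rewrite /split_map -/g /= !mulrDl !mulrDr !mulrzAl !mulrzAr.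
by rewrite ee ff gg ef fe eg ge fg gf !mul0rz !addr0 !add0r !mulrzA_C.
Qed.

HB.instance Definition _ :=
  GRing.isZmodMorphism.Build _ _ (split_map o) split_map_zmod_morphism.
HB.instance Definition _ :=
  GRing.isMonoidMorphism.Build _ _ (split_map o) split_map_monoid_morphism.

End SplitMap.

Lemma orth_idempotents_split (A : pzRingType) (e f : A) :
  orth_idempotents e f ->
  exists g : {rmorphism int * int * int -> A},
    e = g (1, 0, 0) /\ f = g (0, 1, 0).
Proof.
move=> o; exists (split_map o).
by split; rewrite /= /split_map /= !mulr0z mulr1z ?addr0 ?add0r.
Qed.

Section Cocone.
Context {A : nzRingType} {L : localeType locale_display}.
Context {theta : forall B : comPzRingType,
  {rmorphism B -> A} -> locale_hom L (zariski B)}.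
Context (theta_natural : forall (B C : comPzRingType)
  (f : {rmorphism B -> A}) (g : {rmorphism C -> B}) (I : zariski C),
  theta (rmorphism_comp f g) I = theta f (Spec_map g I)).

Definition open_of (a : A) : L := theta (int_eval a) (basic_open 'X).

(** The basic open of x is the image of that of X along the map Z[X] -> B
    sending X to x, whose composite with f is determined by f x. *)
Lemma theta_basic_open (B : comNzRingType) (f : {rmorphism B -> A}) x :
  theta f (basic_open x) = open_of (f x).
Proof.
have -> : basic_open x = Spec_map (int_eval x) (basic_open 'X).
  by rewrite Spec_map_basic_open int_evalX.
rewrite -theta_natural /open_of; congr (theta _ _).
by apply: int_poly_rmorph_ext; rewrite /= !int_evalX.
Qed.

(** Orthogonal idempotents e and f are the images of (1, 0, 0) and (0, 1, 0)
    under a map from Z^3, so the laws are those of the basic opens of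
    Spec(Z^3). *)
Lemma open_of_valuation : idempotent_valuation open_of.
Proof.
split.
- rewrite -(rmorph1 (int_eval 1)) -theta_basic_open basic_open1.
  exact: inverse_image_top.
- move=> e f /orth_idempotents_split[g [-> ->]].
  rewrite -!theta_basic_open -inverse_image_meet basic_open_meet0 //.
  exact: locale_hom0.
- move=> e f /orth_idempotents_split[g [-> ->]].
  by rewrite -rmorphD -!theta_basic_open -locale_homU basic_openD.
Qed.

End Cocone.

(** * Triviality on complex matrices *)

Theorem corollary6p1 (R : realType) (n : nat) (hn : (3 <= n)%N)
    (G : functor (op Ring) Loc)
    (hG : naturally_isomorphic (comp_functor G (op_functor cRing_incl)) Spec) :
  is_initial (G ('M[R[i]]_n : pzRingType)) /\
  isomorphic (G ('M[R[i]]_n : pzRingType)) (opens_locale void).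
Proof.
have [eta [eta_natural _]] := hG.
suff triv : \bot%O = \top%O :> (G ('M[R[i]]_n : pzRingType) : localeType _).
  have GM0 := trivial_initial triv; split=> //.
  apply: initial_isomorphic => //; apply: trivial_initial.
  by apply: val_inj; apply/seteqP; split=> -[].
(* A positive size makes the matrix ring nonzero, as polynomial evaluation in
   it requires. *)
case: n hn => // n hn.
pose theta (B : comPzRingType) (f : {rmorphism B -> 'M[R[i]]_n.+1}) :
    locale_hom (G ('M[R[i]]_n.+1 : pzRingType)) (zariski B) :=
  @Defs.comp Loc _ _ _ (eta B)
    (@Defs.fmap _ _ G ('M[R[i]]_n.+1 : pzRingType) (B : pzRingType) f).
have theta_natural (B C : comPzRingType) (f : {rmorphism B -> 'M[R[i]]_n.+1})
    (g : {rmorphism C -> B}) (I : zariski C) :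
    theta _ (rmorphism_comp f g) I = theta _ f (Spec_map g I).
  suff -> : theta _ (rmorphism_comp f g) = locale_comp (Spec_map g) (theta _ f).
    by [].
  pose f' : @Defs.hom (op Ring) ('M[R[i]]_n.+1 : pzRingType)
    (B : pzRingType) := f.
  pose g' : @Defs.hom (op cRing) B C := g.
  have Gfg := @fmapM _ _ G _ _ _ (Defs.fmap (op_functor cRing_incl) g') f'.
  have := congr1 (fun h => @Defs.comp Loc _ _ _ h (Defs.fmap G f'))
    (eta_natural _ _ g').
  rewrite -!Defs.compA; apply: etrans.
  exact (congr1 (fun h => @Defs.comp Loc _ _ _ (eta C) h) Gfg).
exact: valuation_mx_trivial (open_of_valuation theta_natural) hn.
Qed.
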